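(* Let $I$ be a nonempty closed interval in $\mathbb{R}$ (not necessarily bounded). Then every continuous $2$-rotative function $f:I\to I$ has a fixed point.
   Context: A function $f:I\to I$ is called $2$-rotative if there exists $a\in[0,2)$ such that $|f^2(x)-x|\le a\,|f(x)-x|$ for all $x\in I$, where $f^2=f\circ f$. The closed intervals are exactly the closed convex subsets of $\mathbb{R}$ (possibly unbounded, including $\mathbb{R}$ itself). *)

(* Defs.v *)
From HB Require Import structures.
From mathcomp Require Import all_boot all_order all_algebra.
From mathcomp Require Import all_classical all_reals all_analysis.
Set Implicit Arguments.
Unset Strict Implicit.
Unset Printing Implicit Defensive.
Import Order.TTheory GRing.Theory Num.Theory numFieldNormedType.Exports.
Local Open Scope classical_set_scope.
Local Open Scope ring_scope.

(* A function I -> I is encoded as a total function f : R -> R together with a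
   separate hypothesis that f maps I into I; only the values of f on I matter
   in the definition below. *)
Definition two_rotative (R : realType) (I : set R) (f : R -> R) : Prop :=
  exists a : R, 0 <= a < 2 /\
    forall x : R, I x -> `|f (f x) - x| <= a * `|f x - x|.

(* Main.v *)
Require Import Defs.
From HB Require Import structures.
From mathcomp Require Import all_boot all_order all_algebra.
From mathcomp Require Import all_classical all_reals all_analysis.
From mathcomp Require Import ring lra.
Set Implicit Arguments.
Unset Strict Implicit.
Unset Printing Implicit Defensive.
Import Order.TTheory GRing.Theory Num.Theory numFieldNormedType.Exports.
Local Open Scope classical_set_scope.
Local Open Scope ring_scope.

(** Suppose [x < f x] on all of [I], and put [c = a - 1 < 1]. Rotativity gives
    [f (f x) - f x <= c (f x - x)], i.e. [x |-> f x - c x] does not increase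
    along orbits. So each set [S = {x in I | f x - c x <= K}] is stable under
    [f], and it is bounded above since [(1 - c) x <= f x - c x]. By continuity
    [f] maps the closure of [S] to itself, hence [f (sup S) <= sup S], a
    contradiction. By symmetry [f x < x] cannot hold on all of [I] either, and
    the intermediate value theorem yields a fixed point. *)

(** A limit point [x] of [S] stays in the closed set [A], where continuity relative to [A] applies:
    any neighbourhood of [f x] pulls back to one of [x] within [A], and this meets [S]. *)
Lemma closure_within_continuous (T U : topologicalType) (A S : set T)
    (B : set U) (f : T -> U) :
  closed A -> S `<=` A -> {within A, continuous f} -> set_fun S B f ->
  set_fun (closure S) (closure B) f.
Proof.
move=> clA SA /subspace_continuousP cf fSB x clSx V Vfx.
have Ax : A x by apply: clA; exact: closureS SA _ clSx.
have [y [Sy Vfy]] := clSx _ (cf x Ax V Vfx).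
by exists (f y); split; [exact: fSB|exact: Vfy (SA _ Sy)].
Qed.

Lemma two_rotative_exists_le (R : realType) (I : set R) (f : R -> R) :
  I !=set0 -> closed I -> set_fun I I f -> {within I, continuous f} ->
  two_rotative I f -> exists2 x, I x & f x <= x.
Proof.
move=> [x0 Ix0] clI fI cf [a [/andP[_ a2] rot]].
have [//|noex] := pselect (exists2 x, I x & f x <= x).
have lt_f x : I x -> x < f x.
  by move=> Ix; rewrite ltNge; apply/negP => fx; apply: noex; exists x.
pose g x := f x - (a - 1) * x.
have g_f x : I x -> g (f x) <= g x.
  move=> Ix; have Ifx := fI _ Ix.
  have ltx := lt_f _ Ix; have ltfx := lt_f _ Ifx.
  have := rot _ Ix.
  (* Both displacements are positive, so the absolute values drop and rotativity rearranges to
     [g (f x) <= g x]. *)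
  rewrite (gtr0_norm (_ : 0 < f (f x) - x)) ?subr_gt0 ?(lt_trans ltx)//.
  rewrite gtr0_norm ?subr_gt0// /g => rotx.
  by rewrite -subr_ge0; move: rotx; rewrite -subr_ge0; congr (0 <= _); ring.
pose S := [set x | I x /\ g x <= g x0].
have SI : S `<=` I by move=> x [].
have fS : set_fun S S f.
  by move=> x [Ix gx]; split; [exact: fI|exact: le_trans (g_f _ Ix) gx].
have S0 : S !=set0 by exists x0; split.
have ubS : has_ubound S.
  exists (g x0 / (2 - a)) => x [Ix gx]; rewrite ler_pdivlMr ?subr_gt0//.
  apply: le_trans gx; rewrite /g; have := lt_f _ Ix; lra.
have clSsup : closure S (sup S) by exact: closure_sup.
have Isup : I (sup S) by apply: clI; exact: closureS SI _ clSsup.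
exists (sup S) => //.
(* The closed half-line below [sup S] contains [S], hence its closure, where [f (sup S)] lies. *)
apply: (@closed_le R (sup S)).
apply: closureS (closure_within_continuous clI SI cf fS clSsup).
by move=> x Sx; exact: ub_le_sup.
Qed.

Lemma two_rotative_exists_ge (R : realType) (I : set R) (f : R -> R) :
  I !=set0 -> closed I -> set_fun I I f -> {within I, continuous f} ->
  two_rotative I f -> exists2 x, I x & x <= f x.
Proof.
move=> [x0 Ix0] clI fI /subspace_continuousP cf [a [a02 rot]].
(* Conjugation by the reflection [-%R] preserves the hypotheses and reverses the inequality
   sought. *)
pose h (x : R) := - f (- x).
have [||||| x Ix] := @two_rotative_exists_le R (-%R @^-1` I) h.
- by exists (- x0); rewrite /preimage /= opprK.
- by apply: preimage_closed => // x _; exact: opp_continuous.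
- by move=> x Ix; rewrite /preimage /h /= opprK; exact: fI.
- apply/subspace_continuousP => x Ix; apply: cvgN.
  apply: (cvg_comp -%R f _ (cf (- x) Ix)) => V Vx.
  exact: opp_continuous x _ Vx.
- exists a; split=> // x Ix; rewrite /h opprK.
  by have := rot _ Ix; rewrite ![`|_ - - x|]distrC !(addrC (- x)).
- by rewrite /h lerNl => le_f; exists (- x).
Qed.

Theorem theorem4 (R : realType) (I : set R) (f : R -> R) :
  I !=set0 -> closed I -> is_interval I ->
  set_fun I I f -> {within I, continuous f} ->
  two_rotative I f ->
  exists x : R, I x /\ f x = x.
Proof.
move=> I0 clI itvI fI cf rot.
have [x Ix fx] := two_rotative_exists_le I0 clI fI cf rot.
have [y Iy fy] := two_rotative_exists_ge I0 clI fI cf rot.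
pose g z := f z - z.
have subI u v : I u -> I v -> `[u, v] `<=` I.
  by move=> Iu Iv z /=; rewrite in_itv /=; exact: itvI.
have cg u v : I u -> I v -> {within `[u, v], continuous g}.
  move=> Iu Iv; apply: (continuous_subspaceW (subI _ _ Iu Iv)) => z.
  apply: cvgB; first exact: cf.
  exact: (@continuous_subspaceT _ _ I id (fun=> cvg_id)).
have gx : g x <= 0 by rewrite subr_le0.
have gy : 0 <= g y by rewrite subr_ge0.
suff [z Iz /eqP] : exists2 z, I z & g z = 0.
  by rewrite subr_eq0 => /eqP ?; exists z.
(* The sign change of [g] gives a zero between [x] and [y], whichever comes first. *)
have [xy|/ltW yx] := leP x y.
- have [|z zxy gz] := IVT xy (cg _ _ Ix Iy) (v := 0).
    by rewrite ge_min gx le_max gy orbT.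
  by exists z => //; exact: subI zxy.
- have [|z zyx gz] := IVT yx (cg _ _ Iy Ix) (v := 0).
    by rewrite ge_min gx orbT le_max gy.
  by exists z => //; exact: subI zyx.
Qed.
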